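(* Let $M$ be a compact finite-dimensional manifold. For every continuous map $f\colon M\to M$, the set $\mathcal{O}$ of all observable measures for $f$ is nonempty and weak$^*$-compact.
   Context: Let $m$ be a Lebesgue measure on $M$, normalized so that $m(M)=1$; $m$ is not assumed to be $f$-invariant. Let $\mathcal{P}$ be the set of all Borel probability measures on $M$, endowed with the weak$^*$ topology, and fix a metric $\mathrm{dist}$ on $\mathcal{P}$ inducing this topology. For $x\in M$, let $p\omega(x)\subset\mathcal{P}$ be the set of all weak$^*$ limits of convergent subsequences of the sequence $\left\{\frac1n\sum_{j=0}^{n-1}\delta_{f^j(x)}\right\}_{n\ge 1}$, where $\delta_y$ is the Dirac probability measure supported at $y$. For $\mu\in\mathcal{P}$, $\mathrm{dist}(p\omega(x),\mu)$ denotes the distance from the point $\mu$ to the set $p\omega(x)$. A measure $\mu\in\mathcal{P}$ is called observable (or SRB-like) for $f$ if for every $\varepsilon>0$ the set $A_\varepsilon(\mu)=\{x\in M:\ \mathrm{dist}(p\omega(x),\mu)<\varepsilon\}$ has positive Lebesgue measure $m$. The set of all observable measures for $f$ is denoted $\mathcal{O}$. *)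

(* Defs.v *)
From HB Require Import structures.
From mathcomp Require Import all_boot all_order all_algebra.
From mathcomp Require Import all_classical all_reals all_analysis.
From mathcomp Require Import measurable_realfun.

Set Implicit Arguments.
Unset Strict Implicit.
Unset Printing Implicit Defensive.

Import Order.TTheory GRing.Theory Num.Theory.
Import numFieldNormedType.Exports.

Local Open Scope classical_set_scope.
Local Open Scope ring_scope.

Notation borel T := (g_sigma_algebraType (@open T)).

Definition row_cons (R : realType) (n : nat)
    (tv : measurableTypeR R * borel 'rV[R]_n) : borel 'rV[R]_n.+1 :=
  row_mx (const_mx tv.1 : 'rV[R]_1) (tv.2 : 'rV[R]_n).

Lemma row_cons0 (R : realType) (n : nat) (t : R) (v : 'rV[R]_n) i :
  @row_cons R n (t, v) i ord0 = t.
Proof.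
have -> : ord0 = @lshift 1 n ord0 by exact: val_inj.
by rewrite (@row_mxEl R 1 1 n) mxE.
Qed.

Lemma row_consS (R : realType) (n : nat) (t : R) (v : 'rV[R]_n) i (j : 'I_n) :
  @row_cons R n (t, v) i (lift ord0 j) = v i j.
Proof.
have -> : lift ord0 j = @rshift 1 n j by exact: val_inj.
by rewrite (@row_mxEr R 1 1 n).
Qed.

Lemma row_cons_ball (R : realType) (n : nat) (c : 'rV[R]_n.+1) (e : R) :
  @row_cons R n @^-1` (ball c e) =
  ball (c ord0 ord0) e `*` ball (\row_j c ord0 (lift ord0 j) : 'rV[R]_n) e.
Proof.
apply/seteqP; split=> -[t v] /=.
  move=> [e0 H]; split; first by have := H ord0 ord0; rewrite row_cons0.
  by split=> // i j; have := H i (lift ord0 j); rewrite row_consS ord1 mxE.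
move=> [ct [e0 H]]; split=> // i j; rewrite ord1.
case: (unliftP ord0 j) => [k ->|->]; last by rewrite row_cons0.
by rewrite row_consS; have := H ord0 k; rewrite mxE.
Qed.

Lemma open_rV_bigcup (R : realType) (n : nat) (U : set 'rV[R]_n) : open U ->
  U = \bigcup_(cr in [set cr : 'rV[rat]_n * rat |
        ball (map_mx ratr cr.1 : 'rV[R]_n) (ratr cr.2) `<=` U])
        ball (map_mx ratr cr.1 : 'rV[R]_n) (ratr cr.2).
Proof.
move=> oU; apply/seteqP; split=> [x Ux|x [cr + ]]; last exact.
have /nbhs_ballP[e /= e0 xeU] : nbhs x U by apply: open_nbhs_nbhs.
have [q] := @rat_in_itvoo R 0 (e / 2) (divr_gt0 e0 (ltr0n _ 2)).
rewrite in_itv /= => /andP[q0 qe].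
have /(_ _)/cid-/all_sig[c cP] : forall i, exists p : rat,
    `|x ord0 i - ratr p| < ratr q.
  move=> i; have : x ord0 i - ratr q < x ord0 i + ratr q.
    by rewrite ltrBlDr -addrA ltrDl addr_gt0.
  move=> /rat_in_itvoo[p]; rewrite in_itv /= => /andP[p1 p2].
  by exists p; rewrite ltr_distlC p1 p2.
have cx : ball (map_mx ratr (\row_i c i) : 'rV[R]_n) (ratr q) x.
  by split=> // i j; rewrite ord1 !mxE; apply: ball_sym; exact: cP.
exists (\row_i c i, q) => //= y cy; apply: xeU.
apply: (@le_ball _ _ _ (ratr q + ratr q)).
  by rewrite [leRHS]splitr lerD// ltW.
by apply: ball_triangle cy; exact: ball_sym.
Qed.

Lemma measurable_row_cons (R : realType) (n : nat) :
  measurable_fun [set: measurableTypeR R * borel 'rV[R]_n] (@row_cons R n).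
Proof.
apply: (@measurability _ _ _ (borel 'rV[R]_n.+1) setT (@row_cons R n)
  (@open 'rV[R]_n.+1) erefl).
move=> _ [U oU <-]; rewrite setTI (open_rV_bigcup oU) preimage_bigcup.
rewrite bigcup_mkcond; apply: countable_bigcupT_measurable => //.
case=> c r; case: ifPn => // _; rewrite row_cons_ball.
apply: measurableX; first by rewrite (@ball_itv R); exact: measurable_itv.
by apply: sub_sigma_algebra; exact: ball_open.
Qed.

Definition row_uncons (R : realType) (n : nat) (v : borel 'rV[R]_n.+1) :
    measurableTypeR R * borel 'rV[R]_n :=
  (v ord0 ord0, \row_j v ord0 (lift ord0 j)).

Lemma row_consK (R : realType) (n : nat) :
  cancel (@row_cons R n) (@row_uncons R n).
Proof.
move=> [t v]; rewrite /row_uncons row_cons0; congr pair.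
by apply/rowP => j; rewrite mxE row_consS.
Qed.

Lemma measurable_row_uncons (R : realType) (n : nat) :
  measurable_fun setT (@row_uncons R n).
Proof.
have m0 : measurable_fun setT
    (fun v : borel 'rV[R]_n.+1 => v ord0 ord0 : measurableTypeR R).
  refine (measurability _ (RGenOpens.measurableE R) _).
  move=> _ [_ [x [y ->]] <-]; rewrite setTI; apply: sub_sigma_algebra.
  apply: open_comp; last exact: (@interval_open R).
  by move=> v _; exact: coord_continuous.
have mS : measurable_fun setT (fun v : borel 'rV[R]_n.+1 =>
    (\row_j v ord0 (lift ord0 j) : borel 'rV[R]_n)).
  refine (@measurability _ _ _ (borel 'rV[R]_n) _ _ (@open 'rV[R]_n) erefl _).
  move=> _ [U oU <-]; rewrite setTI; apply: sub_sigma_algebra.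
  apply: open_comp oU => v _ A /nbhs_ballP[e /= e0 eA].
  apply/nbhs_ballP; exists e => //= w [_ vw]; apply: eA; split=> // i j.
  by rewrite !mxE; exact: vw.
exact: measurable_fun_pair m0 mS.
Qed.

Section lebesgue_cons.
Context (R : realType) (n : nat).
Variable mu : {sigma_finite_measure set (borel 'rV[R]_n) -> \bar R}.

Definition lebesgue_cons : set (borel 'rV[R]_n.+1) -> \bar R :=
  pushforward (lebesgue_measure \x mu)%E (@row_cons R n).

Let lebesgue_cons0 : lebesgue_cons set0 = 0%E.
Proof. by rewrite /lebesgue_cons /pushforward preimage_set0 measure0. Qed.

Let lebesgue_cons_ge0 A : (0 <= lebesgue_cons A)%E.
Proof. exact: (measure_ge0 (lebesgue_measure \x mu)%E). Qed.

Let lebesgue_cons_sigma_additive : semi_sigma_additive lebesgue_cons.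
Proof.
have mf A : measurable A -> measurable (@row_cons R n @^-1` A).
  by move=> mA; rewrite -[X in measurable X]setTI; exact: measurable_row_cons.
move=> F mF tF mUF; rewrite /lebesgue_cons /pushforward preimage_bigcup.
apply: measure_semi_sigma_additive.
- by move=> i; exact: mf.
- apply/trivIsetP => /= i j _ _ ij; rewrite -preimage_setI.
  by move/trivIsetP : tF => /(_ _ _ _ _ ij) ->//; rewrite preimage_set0.
- by rewrite -preimage_bigcup; exact: mf.
Qed.

HB.instance Definition _ := isMeasure.Build _ _ _ lebesgue_cons
  lebesgue_cons0 lebesgue_cons_ge0 lebesgue_cons_sigma_additive.

Let lebesgue_cons_sigma_finite : sigma_finite setT lebesgue_cons.
Proof.
have /sigma_finiteP[F [TF ndF Foo]] := sigma_finiteT (@lebesgue_measure R).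
have /sigma_finiteP[G [TG ndG Goo]] := sigma_finiteT mu.
exists (fun k => @row_uncons R n @^-1` (F k `*` G k)).
  apply/esym; rewrite -subTset => v _.
  have : setT (row_uncons v).1 by [].
  have : setT (row_uncons v).2 by [].
  rewrite {1}TF {1}TG => -[j _ Gj] [i _ Fi]; exists (maxn i j) => //; split.
    by move: Fi; exact/subsetPset/ndF/leq_maxl.
  by move: Gj; exact/subsetPset/ndG/leq_maxr.
move=> k; have [mF Fk] := Foo k; have [mG Gk] := Goo k; split.
  rewrite -[X in measurable X]setTI; apply: measurable_row_uncons => //.
  exact: measurableX.
rewrite /lebesgue_cons /pushforward -comp_preimage.
rewrite (_ : _ @^-1` _ = F k `*` G k).
  by rewrite product_measure1E// lte_mul_pinfty// ge0_fin_numE.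
by rewrite (_ : _ \o _ = id)//; apply/funext => x; exact: row_consK.
Qed.

HB.instance Definition _ := Measure_isSigmaFinite.Build _ _ _ lebesgue_cons
  lebesgue_cons_sigma_finite.

End lebesgue_cons.

(* Lebesgue measure on R^n as the n-fold product of Lebesgue measure on R. *)
Fixpoint lebesgue_rV (R : realType) (n : nat) :
    {sigma_finite_measure set (borel 'rV[R]_n) -> \bar R} :=
  if n is n'.+1 then lebesgue_cons (lebesgue_rV R n')
  else @dirac _ (borel 'rV[R]_0) (0 : 'rV[R]_0) R.

(* A library measure is a function on all sets, constrained only on measurable
   ones.  Values off the Borel sets are fixed to 0 so that equality in
   [borel_probability] is equality of Borel measures and the weak* topology
   is Hausdorff. *)
Definition borel_probability (R : realType) (M : ptopologicalType) : Type :=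
  {mu : probability (borel M) R | `[< forall A, ~ measurable A -> mu A = 0%E >]}.

HB.instance Definition _ R M := Choice.on (@borel_probability R M).

Coercion borel_probability_val (R : realType) (M : ptopologicalType)
  (mu : borel_probability R M) : probability (borel M) R := val mu.

Section borel_restriction.
Context (R : realType) (M : ptopologicalType).
Variable mu : probability (borel M) R.

Definition borel_restr (A : set (borel M)) : \bar R :=
  if `[< measurable A >] then mu A else 0%E.

Let borel_restr0 : borel_restr set0 = 0%E.
Proof. by rewrite /borel_restr measure0; case: ifP. Qed.

Let borel_restr_ge0 A : (0 <= borel_restr A)%E.
Proof. by rewrite /borel_restr; case: ifP. Qed.

Let borel_restr_sigma_additive : semi_sigma_additive borel_restr.
Proof.
have E A : measurable A -> borel_restr A = mu A.
  by move=> /asboolT; rewrite /borel_restr => ->.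
move=> F mF tF mUF; rewrite E//.
under eq_fun do under eq_bigr do rewrite E//.
exact: measure_semi_sigma_additive.
Qed.

HB.instance Definition _ := isMeasure.Build _ _ _ borel_restr
  borel_restr0 borel_restr_ge0 borel_restr_sigma_additive.

Let borel_restr_setT : borel_restr setT = 1%E.
Proof. by rewrite /borel_restr asboolT// probability_setT. Qed.

HB.instance Definition _ := Measure_isProbability.Build _ _ _ borel_restr
  borel_restr_setT.

Lemma borel_restr_null :
  `[< forall A, ~ measurable A -> (borel_restr : probability _ R) A = 0%E >].
Proof. by apply/asboolP => A /= /asboolPn; rewrite /borel_restr => /negbTE ->. Qed.

Definition to_borel_probability : borel_probability R M :=
  exist _ (borel_restr : probability _ R) borel_restr_null.

End borel_restriction.

Section weak_star.
Context (R : realType) (M : ptopologicalType).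

Definition wstar_eval (mu : borel_probability R M) :
    {ptws continuousType M R -> R} :=
  fun phi => \int[mu]_x phi x.

(* The coarsest topology making mu |-> \int phi dmu continuous for every
   continuous phi : M -> R. *)
Definition wstar : topologicalType := initial_topology wstar_eval.

Definition metric_inducing_wstar (dist : wstar -> wstar -> R) : Prop :=
  [/\ forall mu nu, dist mu nu = 0 <-> mu = nu,
      forall mu nu, dist mu nu = dist nu mu,
      forall mu nu rho, dist mu rho <= dist mu nu + dist nu rho &
      forall mu (A : set wstar),
        nbhs mu A <-> exists2 e, 0 < e & [set nu | dist mu nu < e] `<=` A].

End weak_star.

Section empirical.
Context (R : realType) (M : ptopologicalType) (f : M -> M) (x : M) (n : nat).

(* Indices are shifted: this is the average over the n.+1 points
   x, f x, ..., f^n x. *)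
Definition empirical_measure : set (borel M) -> \bar R :=
  mscale (n.+1%:R^-1)%:nng
    (msum (fun j => dirac (iter j f x : borel M)) n.+1).

HB.instance Definition _ := Measure.on empirical_measure.

Let empirical_measure_setT : empirical_measure setT = 1%E.
Proof.
have -> : empirical_measure setT = ((n.+1%:R^-1)%:E *
    \sum_(j < n.+1) \d_(iter j f x : borel M) [set: borel M])%E by [].
rewrite (eq_bigr (fun=> 1%:E)) => [|j _]; last exact: diracT.
rewrite sumEFin -EFinM big_const_ord iter_addr addr0 -[_ *+ _]mulr_natl mulr1.
by rewrite mulVf// pnatr_eq0.
Qed.

HB.instance Definition _ := Measure_isProbability.Build _ _ _ empirical_measure
  empirical_measure_setT.

Definition empirical : wstar R M :=
  to_borel_probability (empirical_measure : probability _ R).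
End empirical.

Section observable.
Context (R : realType) (M : ptopologicalType).
Variables (dist : wstar R M -> wstar R M -> R) (m : borel_probability R M).
Variable f : M -> M.

Definition pomega (x : M) : set (wstar R M) :=
  [set mu | exists2 s : nat -> nat, {homo s : i j / (i < j)%N} &
    (fun k => empirical R f x (s k)) @ \oo --> mu].

(* Valued in the extended reals so that the distance to the empty set is +oo. *)
Definition dist_to_set (mu : wstar R M) (K : set (wstar R M)) : \bar R :=
  ereal_inf [set (dist mu nu)%:E | nu in K].

(* A Borel set when M is compact metrizable and f is continuous: the distance
   is then the liminf of the distances from mu to the empirical measures. *)
Definition basin (mu : wstar R M) (eps : R) : set M :=
  [set x | (dist_to_set mu (pomega x) < eps%:E)%E].

Definition observable : set (wstar R M) :=
  [set mu | forall eps, 0 < eps -> (0 < m (basin mu eps))%E].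

End observable.

Section manifold.
Context (R : realType) (n : nat).

(* In finite dimension, continuity of 'd g y v in y for each fixed v is
   continuity of the differential. *)
Definition C1_on (D : set 'rV[R]_n) (g : 'rV[R]_n -> 'rV[R]_n) : Prop :=
  forall x, D x -> differentiable g x /\
    forall v, {for x, continuous (fun y => 'd g y v)}.

(* [chart_map] and [chart_inv] are total functions, only meaningful on
   [chart_dom] and on its image respectively. *)
Record chart (M : topologicalType) := Chart {
  chart_dom : set M ;
  chart_map : M -> 'rV[R]_n ;
  chart_inv : 'rV[R]_n -> M ;
  chart_dom_open : open chart_dom ;
  chart_img_open : open (chart_map @` chart_dom) ;
  chart_mapK : {in chart_dom, cancel chart_map chart_inv} ;
  chart_map_continuous : {in chart_dom, continuous chart_map} ;
  chart_inv_continuous : {in chart_map @` chart_dom, continuous chart_inv} }.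

Record C1_atlas (M : topologicalType) := C1Atlas {
  charts : set (chart M) ;
  charts_cover : \bigcup_(c in charts) chart_dom c = setT ;
  charts_compat : forall c c', charts c -> charts c' ->
    C1_on (chart_map c @` (chart_dom c `&` chart_dom c'))
          (chart_map c' \o chart_inv c) }.

(* A Lebesgue measure on a manifold: in every chart of the atlas, a continuous
   positive density with respect to the Lebesgue measure of R^n. *)
Definition lebesgue_on (M : ptopologicalType) (A : C1_atlas M)
    (m : borel_probability R M) : Prop :=
  forall c, charts A c -> exists rho : 'rV[R]_n -> R,
    [/\ {in chart_map c @` chart_dom c, continuous rho},
        forall y, (chart_map c @` chart_dom c) y -> 0 < rho y &
        forall B : set (borel M), measurable B -> B `<=` chart_dom c ->
          m B = (\int[lebesgue_rV R n]_(y in chart_map c @` B) (rho y)%:E)%E].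

End manifold.

(* Main.v *)
From HB Require Import structures.
Require Import Defs.
From mathcomp Require Import all_boot all_order all_algebra.
From mathcomp Require Import all_classical all_reals all_analysis.
From mathcomp Require Import measurable_realfun lra.

Set Implicit Arguments.
Unset Strict Implicit.
Unset Printing Implicit Defensive.

Import Order.TTheory GRing.Theory Num.Theory.
Import numFieldNormedType.Exports.

Local Open Scope classical_set_scope.
Local Open Scope ring_scope.

(** Write P for the space of Borel probabilities on M with the weak* topology.

    P is compact. Let F be an ultrafilter on P. For each Borel set A the masses
    mu A converge along F, since they stay in [0, 1]; call the limit kappa A
    ([limit_mass]). The set function kappa is finitely additive, but in general
    not countably additive, because mass can leak to the boundary of a set in
    the limit. It is repaired by regularization: its values on closed sets alone
    determine a genuine Borel measure nu with
    nu U = sup {kappa K : K closed, K contained in U} for U open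
    ([content_borel_measure]), built as a Caratheodory measure; compactness of M
    gives countable subadditivity and normality gives the splitting of closed
    sets. In particular nu U <= kappa U for every open U. Approximating a
    continuous phi from both sides by step functions on its open superlevel sets
    ([Rintegral_level_sum]) turns this into an inequality between the integral
    of phi under nu and the limit along F of its integrals under mu
    ([le_limit_Rintegral]); the same inequality for - phi makes it an equality,
    so F converges to nu.

    Basins are Borel. The empirical measures are continuous functions of the
    starting point, and by compactness of P the point x lies in the
    basin of mu at scale eps exactly when, for some j, infinitely many empirical
    measures of x are within eps - 1 / (j + 1) of mu ([basin_limsup]).
    So the basin is a countable combination of open sets. This matters because
    [m] is monotone and subadditive on Borel sets only.

    Observable measures exist. Declare a set S of measures large when, for
    m-almost every x, all limits of the empirical measures of x lie in S. Every
    x has such a limit, so the large sets form a proper filter, and by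
    compactness of P it has a cluster point mu. If some basin of mu were m-null,
    the complement of a ball around mu would be large, contradicting that mu is
    a cluster point.

    Observable measures form a closed set, because the basin of mu at scale eps
    contains the basin at scale eps / 2 of every measure that is eps / 2-close
    to mu; a closed subset of P is compact. *)

(** * A Borel measure from a finite content on closed sets *)

Section content_measure.
Context (R : realType) (T : ptopologicalType).
Hypotheses (T_normal : normal_space T) (T_compact : compact [set: T]).

(** The two pieces of [A] left over by [U] and by [V] are disjoint closed sets;
    removing from [A] disjoint open neighbourhoods of them gives the parts. *)
Lemma closed_splitU (A U V : set T) :
  closed A -> open U -> open V -> A `<=` U `|` V ->
  exists B C, [/\ closed B, closed C, B `<=` U, C `<=` V & A = B `|` C].
Proof.
move=> cA oU oV AUV.
have cD W : open W -> closed (A `\` W).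
  by move=> oW; apply: closedI => //; exact: open_closedC.
have D0 : (A `\` U) `&` (A `\` V) = set0.
  by rewrite -subset0 => x [[Ax nU] [_ nV]]; have [] := AUV _ Ax.
have [P [Q [oP oQ UP VQ PQ]]] :=
  (normal_openP (R := R)).1 T_normal _ _ (cD _ oU) (cD _ oV) D0.
exists (A `\` P), (A `\` Q); split; try exact: cD.
- by move=> x [Ax nP]; apply: contrapT => nU; apply: nP; exact: UP.
- by move=> x [Ax nQ]; apply: contrapT => nV; apply: nQ; exact: VQ.
- apply/seteqP; split=> x; last by move=> [[]|[]].
  move=> Ax; have [Px|nP] := pselect (P x); last by left.
  by right; split => // Qx; rewrite -[False]/(set0 x) -PQ.
Qed.

Variable kap : set T -> R.
Hypothesis le_kap : forall A B,
  closed A -> closed B -> A `<=` B -> kap A <= kap B.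
Hypothesis kapU_le : forall A B,
  closed A -> closed B -> kap (A `|` B) <= kap A + kap B.
Hypothesis kapU : forall A B,
  closed A -> closed B -> A `&` B = set0 -> kap (A `|` B) = kap A + kap B.

Let kap0 : kap set0 = 0.
Proof.
have := kapU (@closed0 T) (@closed0 T) (setI0 set0).
rewrite setU0 => /eqP.
by rewrite -subr_eq0 opprD addrA subrr sub0r oppr_eq0 => /eqP.
Qed.

Local Open Scope ereal_scope.

Definition inner_content (U : set T) : \bar R :=
  ereal_sup [set (kap K)%:E | K in [set K | closed K /\ K `<=` U]].

Definition outer_content (A : set T) : \bar R :=
  ereal_inf [set inner_content U | U in [set U | open U /\ A `<=` U]].

Lemma kap_le_inner K U : closed K -> K `<=` U -> (kap K)%:E <= inner_content U.
Proof. by move=> cK KU; apply: ereal_sup_ubound; exists K. Qed.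

Lemma le_inner_content U V : U `<=` V -> inner_content U <= inner_content V.
Proof.
move=> UV; apply: ge_ereal_sup => _ [K [cK KU] <-].
by apply: kap_le_inner => //; exact: subset_trans UV.
Qed.

Lemma inner_content_ge0 U : 0 <= inner_content U.
Proof. by have := kap_le_inner (@closed0 T) (@sub0set _ U); rewrite kap0. Qed.

Lemma inner_content_closed K : closed K -> inner_content K = (kap K)%:E.
Proof.
move=> cK; apply/eqP; rewrite eq_le kap_le_inner// andbT.
by apply: ge_ereal_sup => _ [L [cL LK] <-]; rewrite lee_fin le_kap.
Qed.

Lemma outer_content_open U : open U -> outer_content U = inner_content U.
Proof.
move=> oU; apply/eqP; rewrite eq_le; apply/andP; split.
  by apply: ereal_inf_lbound; exists U => //; split.
by apply: le_ereal_inf_tmp => _ [V [oV UV] <-]; exact: le_inner_content.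
Qed.

Lemma le_outer_content : {homo outer_content : A B / A `<=` B >-> A <= B}.
Proof.
move=> A B AB; apply: le_ereal_inf_tmp => _ [U [oU BU] <-].
apply: ereal_inf_lbound; exists U => //; split => //.
exact: subset_trans BU.
Qed.

Lemma outer_content_ge0 A : 0 <= outer_content A.
Proof.
by apply: le_ereal_inf_tmp => _ [U _ <-]; exact: inner_content_ge0.
Qed.

Lemma outer_content0 : outer_content set0 = 0.
Proof.
by rewrite outer_content_open ?inner_content_closed ?kap0//;
  [exact: closed0|exact: open0].
Qed.

Lemma outer_content_fin_num A : outer_content A \is a fin_num.
Proof.
rewrite ge0_fin_numE ?outer_content_ge0//.
apply: (@le_lt_trans _ _ (kap setT)%:E); last exact: ltry.
rewrite -inner_content_closed; last exact: closedT.
rewrite -outer_content_open; last exact: openT.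
exact: le_outer_content.
Qed.

Lemma kap_bigsetU_le (U : (set T)^nat) n K : closed K ->
  (forall i, open (U i)) -> K `<=` \big[setU/set0]_(i < n) U i ->
  (kap K)%:E <= \sum_(i < n) inner_content (U i).
Proof.
move=> + oU; elim: n K => [|n IH] K cK.
  by rewrite !big_ord0 subset0 => ->; rewrite kap0.
rewrite !big_ord_recr/= => KU.
have oV : open (\big[setU/set0]_(i < n) U i).
  by rewrite -bigcup_mkord; exact: bigcup_open.
have [A [B [cA cB AV BU KAB]]] := closed_splitU cK oV (oU n) KU.
apply: (@le_trans _ _ ((kap A)%:E + (kap B)%:E)).
  by rewrite KAB -EFinD lee_fin kapU_le.
by apply: leeD; [exact: IH|exact: kap_le_inner].
Qed.

(** A closed subset of the union is compact, hence inside finitely many of the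
    [U i]: this is where countable subadditivity comes from. *)
Lemma inner_content_bigcup (U : (set T)^nat) : (forall i, open (U i)) ->
  inner_content (\bigcup_i U i) <= \sum_(i <oo) inner_content (U i).
Proof.
move=> oU; apply: ge_ereal_sup => _ [K [cK KU] <-].
have cmptK : compact K by apply: (subclosed_compact cK T_compact).
have [D _ KD] : finite_subset_cover setT U K.
  by move: cmptK; rewrite compact_cover; apply.
pose n := (\max_(i <- finmap.enum_fset D) i).+1%N.
apply: (@le_trans _ _ (\sum_(i < n) inner_content (U i))).
  apply: kap_bigsetU_le => // x /KD [i iD Uix].
  rewrite -bigcup_mkord; exists i => //=; rewrite ltnS.
  exact: (@leq_bigmax_seq _ (finmap.enum_fset D) xpredT id).
rewrite -(big_mkord xpredT (fun i => inner_content (U i))).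
by apply: nneseries_lim_ge => i _ _; exact: inner_content_ge0.
Qed.

Lemma outer_content_sigma_subadditive : sigma_subadditive outer_content.
Proof.
move=> A; apply/lee_addgt0Pr => e e0.
apply: le_trans (epsilon_trick _ _ (ltW e0)); last first.
  by move=> n; exact: outer_content_ge0.
have /choice[U UP] n : exists U, [/\ open U, A n `<=` U &
    inner_content U <= outer_content (A n) + (e / (2 ^ n.+1)%:R)%:E].
  have en : (0 < e / (2 ^ n.+1)%:R)%R.
    by rewrite divr_gt0// ltr0n expn_gt0.
  have [_ [U [oU AU] <-]] :=
    lb_ereal_inf_adherent en (outer_content_fin_num (A n)).
  by move=> /ltW lU; exists U.
apply: (@le_trans _ _ (\sum_(i <oo) inner_content (U i))); last first.
  apply: lee_nneseries => i _; first by move=> _; exact: inner_content_ge0.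
  by have [] := UP i.
apply: le_trans (inner_content_bigcup _); last by move=> i; have [] := UP i.
apply: ereal_inf_lbound; exists (\bigcup_i U i) => //; split.
  by apply: bigcup_open => i _; have [] := UP i.
by apply: subset_bigcup => i _; have [] := UP i.
Qed.

Definition content_outer_measure : {outer_measure set T -> \bar R} :=
  HB.pack outer_content (isOuterMeasure.Build R T outer_content outer_content0
    outer_content_ge0 le_outer_content outer_content_sigma_subadditive).

(** Inside an open [V], first exhaust [V `&` U] by a closed [K], then the open
    set [V `\` K], which still contains [V `\` U], by a closed [L]. As [K] and
    [L] are disjoint, additivity of the content bounds the sum by the value
    at [V]. *)
Lemma open_caratheodory U : open U -> content_outer_measure.-caratheodory U.
Proof.
move=> oU; apply: le_caratheodory_measurable => X /=.
apply: le_ereal_inf_tmp => _ [V [oV XV] <-].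
apply: (@le_trans _ _ (outer_content (V `&` U) + outer_content (V `&` ~` U))).
  by apply: leeD; apply: le_outer_content; exact: setSI.
rewrite outer_content_open; last exact: openI.
rewrite -leeBrDr ?outer_content_fin_num//.
apply: ge_ereal_sup => _ [K [cK KVU] <-].
rewrite leeBrDr ?outer_content_fin_num// addeC -leeBrDr//.
apply: (@le_trans _ _ (inner_content (V `\` K))).
  apply: ereal_inf_lbound; exists (V `\` K) => //; split.
    by apply: openI => //; exact: closed_openC.
  by move=> x [Vx nUx]; split => // /KVU[].
apply: ge_ereal_sup => _ [L [cL LVK] <-].
rewrite leeBrDr// -EFinD -kapU//.
  apply: kap_le_inner; first exact: closedU.
  by move=> x [/LVK[]|/KVU[]].
by rewrite -subset0 => x [/LVK[]].
Qed.

Lemma borel_caratheodory (A : set (borel T)) :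
  measurable A -> content_outer_measure.-caratheodory A.
Proof.
apply: (@smallest_sub _ (sigma_algebra setT) _
  (content_outer_measure.-cara.-measurable)).
  exact: sigma_algebra_measurable.
exact: open_caratheodory.
Qed.

Definition content_measure (A : set (borel T)) : \bar R := outer_content A.

Lemma content_measure_sigma_additive : semi_sigma_additive content_measure.
Proof.
move=> F mF tF mUF.
exact: (@caratheodory_measure_sigma_additive _ _ content_outer_measure F
  (fun i => borel_caratheodory (mF i)) tF (borel_caratheodory mUF)).
Qed.

Theorem content_borel_measure :
  exists mu : {measure set (borel T) -> \bar R},
    mu setT = (kap setT)%:E /\ forall U, open U -> mu U = inner_content U.
Proof.
pose mu : {measure set (borel T) -> \bar R} := HB.pack content_measure
  (isMeasure.Build _ (borel T) R content_measure outer_content0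
    outer_content_ge0 content_measure_sigma_additive).
exists mu; split; last exact: outer_content_open.
rewrite -inner_content_closed; last exact: closedT.
by apply: outer_content_open; exact: openT.
Qed.

End content_measure.

(** * Integrals of continuous functions as limits of level sums *)

(** An ultrafilter containing the preimage of a compact set converges at any
    cluster point of its image. *)
Lemma ultra_cvg_bounded (T : Type) (R : realType) (F : set_system T)
    (u : T -> R) (C : R) : UltraFilter F -> (forall x, `|u x| <= C) ->
  cvg (u x @[x --> F]).
Proof.
move=> FU uC; have FP : ProperFilter F by exact: ultra_proper.
have uF : (u x @[x --> F]) `[- C, C]%classic.
  by apply: nearW => x /=; rewrite in_itv/= -ler_norml.
have [l [_ ul]] := @segment_compact R (- C) C _ (fmap_proper_filter u FP) uF.
apply/cvg_ex; exists l => A lA.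
have [//|FnA] := in_ultra_setVsetC (u @^-1` A) FU.
by have [y []] := ul (~` A) A FnA lA.
Qed.

(** Each threshold [a + e *+ i.+1] that [t] exceeds contributes one step [e], so
    the sum rounds [t - a] down to a multiple of [e]. When [t] is itself such a
    multiple the strict inequality loses one more step, whence the weak upper
    bound. *)
Lemma level_sum_bounds (R : realType) (a e t : R) N : 0 <= e ->
  a <= t -> t <= a + e *+ N ->
  let S := \sum_(i < N) e * ((a + e *+ i.+1 < t)%R : nat)%:R in
  a + S <= t /\ t <= a + e + S.
Proof.
move=> e0; elim: N a => [|N IH] a at_ tN /=.
  by move: tN; rewrite big_ord0 mulr0n => tN; split; lra.
rewrite big_ord_recl/= mulr1n.
have [lt_t|ge_t] := ltP (a + e) t; rewrite /= ?mulr1 ?mulr0n ?mulr0.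
  have := IH (a + e) (ltW lt_t); rewrite -addrA -mulrS => /(_ tN) /=.
  under eq_bigr => i _ do rewrite -addrA -mulrS.
  by move: (\sum_(i < N) _) => S [lo hi]; split; lra.
rewrite big1 => [|i _]; first by split; lra.
rewrite ltNge (_ : t <= _) ?mulr0//.
by rewrite (le_trans ge_t)// lerD2l mulrS lerDl mulrn_wge0.
Qed.

Section compact_integral.
Context (R : realType) (M : ptopologicalType).
Hypothesis M_compact : compact [set: M].

Lemma continuous_borel_measurable (phi : M -> R) :
  continuous phi -> measurable_fun [set: borel M] phi.
Proof.
move=> cphi; refine (measurability _ (RGenOpens.measurableE R) _).
move=> _ [_ [x [y ->]] <-]; rewrite setTI; apply: sub_sigma_algebra.
by apply: open_comp; [move=> v _; exact: cphi|exact: (@interval_open R)].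
Qed.

Lemma continuous_compact_bound (phi : M -> R) : continuous phi ->
  exists C : R, forall x, `|phi x| <= C.
Proof.
move=> cphi.
have : compact (phi @` [set: M]).
  by apply: continuous_compact => //; exact: continuous_subspaceT.
move=> /compact_bounded [C [_ CP]]; exists (C + 1) => x.
by apply: (CP (C + 1)); [rewrite ltrDl|exists x].
Qed.

Lemma bounded_borel_integrable (P : probability (borel M) R)
    (phi : borel M -> R) C :
  measurable_fun setT phi -> (forall x, `|phi x| <= C) ->
  P.-integrable setT (EFin \o phi).
Proof.
move=> mphi phiC; apply: measurable_bounded_integrable => //.
  by apply: le_lt_trans (probability_le1 P measurableT) _; rewrite ltry.
exists C; split; first exact: num_real.
by move=> c /ltW Cc x _; exact: le_trans (phiC x) Cc.
Qed.

Lemma continuous_borel_integrable (P : probability (borel M) R) (phi : M -> R) :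
  continuous phi -> P.-integrable [set: borel M] (EFin \o phi).
Proof.
move=> cphi; have [C phiC] := continuous_compact_bound cphi.
exact: bounded_borel_integrable (continuous_borel_measurable cphi) phiC.
Qed.

Lemma RintegralN_continuous (P : probability (borel M) R) (phi : M -> R) :
  continuous phi -> \int[P]_x (- phi x) = - \int[P]_x phi x.
Proof.
move=> cphi; under eq_Rintegral => x _ do rewrite -mulN1r.
by rewrite RintegralZl ?mulN1r//; exact: continuous_borel_integrable.
Qed.

Lemma open_superlevel (phi : M -> R) c : continuous phi ->
  open [set x | c < phi x].
Proof.
by move=> cphi; apply: (open_comp _ (@open_gt R c)) => x _; exact: cphi.
Qed.

(** The bounds involve [P] through open sets only, which is all that is known
    when comparing two probabilities by their values on open sets. *)
Lemma Rintegral_level_sum (P : probability (borel M) R) (phi : M -> R)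
    (a e : R) N : continuous phi -> 0 <= e ->
  (forall x, a <= phi x <= a + e *+ N) ->
  let S := \sum_(i < N) e * fine (P [set x | a + e *+ i.+1 < phi x]) in
  a + S <= \int[P]_x phi x /\ \int[P]_x phi x <= a + e + S.
Proof.
move=> cphi e0 phiN S.
pose U i := [set x : borel M | a + e *+ i.+1 < phi x].
have mU i : measurable (U i).
  by apply: sub_sigma_algebra; exact: open_superlevel.
pose g (x : borel M) := \sum_(i < N) e * \1_(U i) x.
have ig i : P.-integrable setT (EFin \o (fun x => e * \1_(U i) x)).
  by apply: (integrableZl measurableT e (integrable_indic P (mU i))).
have gP x : a + g x <= phi x /\ phi x <= a + e + g x.
  have /andP[lo hi] := phiN x.
  have := level_sum_bounds e0 lo hi => /=.
  rewrite /g; under [in X in _ -> X]eq_bigr => i _ do rewrite indicE mem_setE.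
  by [].
have intg : P.-integrable setT (EFin \o g).
  rewrite (_ : _ \o _ = fun x => \sum_(i < N) (e * \1_(U i) x)%:E); last first.
    by apply/funext => x /=; rewrite sumEFin.
  by apply: integrable_sum => // i _; exact: ig.
have SE : \int[P]_x g x = S.
  rewrite /Rintegral /g; under eq_integral do rewrite -sumEFin.
  rewrite integral_sum//; last exact: ig.
  rewrite -sum_fine; last by move=> i _; exact: integrable_fin_num (ig i).
  apply: eq_bigr => i _; rewrite -/(Rintegral _ _ _).
  rewrite RintegralZl//; last exact: integrable_indic.
  by rewrite /Rintegral integral_indic// setIT.
have icst (c : R) : P.-integrable setT (EFin \o cst c).
  exact: finite_measure_integrable_cst.
have cstE (c : R) : \int[P]_x (c + g x) = c + S.
  rewrite RintegralD//; last exact: icst.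
  by rewrite Rintegral_cst// [X in fine X]probability_setT mulr1 SE.
have iphi := continuous_borel_integrable P cphi.
have icg (c : R) : P.-integrable setT (EFin \o (fun x => c + g x)).
  exact: integrableD (icst c) intg.
by split; rewrite -cstE; apply: le_Rintegral => // x _; have [] := gP x.
Qed.

End compact_integral.

(** * Weak* compactness of the Borel probabilities *)

Lemma cvg_initial (S : choiceType) (T : topologicalType) (f : S -> T)
    (F : set_system (initial_topology f)) (s : initial_topology f) : Filter F ->
  F --> s <-> f x @[x --> F] --> f s.
Proof.
move=> FF; split=> [Fs|fFs].
  by apply: cvg_comp Fs _; exact: (@initial_continuous _ _ f).
move=> A /= [_ [[B oB <-] Bs] BA]; apply: filterS BA _.
by apply: fFs; exact: open_nbhs_nbhs.
Qed.

Lemma cvg_wstar (R : realType) (M : ptopologicalType)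
    (F : set_system (wstar R M)) (mu : wstar R M) : Filter F ->
  F --> mu <->
  forall phi : continuousType M R,
    wstar_eval nu phi @[nu --> F] --> wstar_eval mu phi.
Proof.
move=> FF; rewrite (cvg_initial mu FF) cvg_sup.
split=> + phi => /(_ phi); last by move=> ?; apply/cvg_initial.
by move/cvg_initial.
Qed.

Lemma Rintegral_borel_restr (R : realType) (M : ptopologicalType)
    (P : probability (borel M) R) (phi : M -> R) :
  \int[to_borel_probability P]_x phi x = \int[P]_x phi x.
Proof.
congr fine; apply: eq_measure_integral => A mA _.
by rewrite /= /borel_restr asboolT.
Qed.

Section unit_mass.
Context d (T : measurableType d) (R : realType).
Variables (mu : {measure set T -> \bar R}) (mu1 : mu setT = 1%E).

(** A copy of [mu] carrying the proof that its total mass is one, to which the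
    probability structure can be attached. *)
Definition unit_mass (_ : mu setT = 1%E) : set T -> \bar R := mu.

HB.instance Definition _ := Measure.copy (unit_mass mu1) mu.
HB.instance Definition _ :=
  Measure_isProbability.Build _ _ _ (unit_mass mu1) mu1.

End unit_mass.

Section wstar_compact.
Context (R : realType) (M : ptopologicalType).
Hypotheses (M_hausdorff : hausdorff_space M) (M_compact : compact [set: M]).

Section limit_content.
Variable F : set_system (wstar R M).
Hypothesis F_ultra : UltraFilter F.

Let F_proper : ProperFilter F. Proof. exact: ultra_proper. Qed.
Local Existing Instance F_proper.

Let mass (A : set (borel M)) (mu : borel_probability R M) : R := fine (mu A).

Definition limit_mass (A : set (borel M)) : R := lim (mass A mu @[mu --> F]).

Lemma cvg_limit_mass A : measurable A -> mass A mu @[mu --> F] --> limit_mass A.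
Proof.
move=> mA; apply: (@ultra_cvg_bounded _ _ _ (mass A) 1) => // mu.
rewrite /mass ger0_norm ?fine_ge0// -lee_fin fineK ?fin_num_measure//.
exact: probability_le1.
Qed.

Lemma le_limit_mass A B : measurable A -> measurable B -> A `<=` B ->
  limit_mass A <= limit_mass B.
Proof.
move=> mA mB AB; apply: ler_cvg_to (cvg_limit_mass mA) (cvg_limit_mass mB) _.
apply: nearW => mu; rewrite /mass fine_le ?fin_num_measure//.
by apply: le_measure; rewrite ?inE.
Qed.

Lemma limit_massU A B : measurable A -> measurable B -> A `&` B = set0 ->
  limit_mass (A `|` B) = limit_mass A + limit_mass B.
Proof.
move=> mA mB AB; apply/cvg_lim => //.
rewrite (_ : mass (A `|` B) = fun mu => mass A mu + mass B mu).
  by apply: cvgD; exact: cvg_limit_mass.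
apply/funext => mu; rewrite /mass -fineD ?fin_num_measure//.
by rewrite measureU.
Qed.

Lemma limit_massU_le A B : measurable A -> measurable B ->
  limit_mass (A `|` B) <= limit_mass A + limit_mass B.
Proof.
move=> mA mB; have mBA : measurable (B `\` A) by exact: measurableD.
rewrite (_ : A `|` B = A `|` (B `\` A)); last by rewrite setUDr setDv setD0.
by rewrite limit_massU ?setDIK// lerD2l le_limit_mass//; exact: subDsetl.
Qed.

Lemma limit_massT : limit_mass setT = 1.
Proof.
apply/cvg_lim => //; rewrite (_ : mass _ = cst 1); first exact: cvg_cst.
by apply/funext => mu; rewrite /mass probability_setT.
Qed.

(** For a fixed step [e], compare the level sums of [phi] under [P] and under
    [mu], and pass to the limit along [F] in the finitely many masses. *)
Lemma le_limit_Rintegral (P : probability (borel M) R) (phi : M -> R) (l : R) :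
  (forall U, open U -> fine (P U) <= limit_mass U) -> continuous phi ->
  (fun mu : borel_probability R M => \int[mu]_x phi x) @ F --> l ->
  \int[P]_x phi x <= l.
Proof.
move=> PO cphi phil; have [C phiC] := continuous_compact_bound M_compact cphi.
apply/ler_addgt0Pr => e e0.
(* N steps of size e cover the range [- C, C] of phi *)
have [N CN] : exists N, forall x, - C <= phi x <= - C + e *+ N.
  have := truncnS_gt (C *+ 2 / e); rewrite ltr_pdivrMr// => Ck.
  exists (Num.truncn (C *+ 2 / e)).+1 => x.
  have := phiC x; rewrite ler_norml => /andP[-> xC] /=.
  rewrite -mulr_natl -lerBlDl opprK (le_trans _ (ltW Ck))//.
  by rewrite mulr2n lerD2r.
have [_ /le_trans] := Rintegral_level_sum M_compact P cphi (ltW e0) CN; apply.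
rewrite -addrA addrCA addrC lerD2r.
pose U i := [set x | - C + e *+ i.+1 < phi x].
have oU i : open (U i) by exact: open_superlevel.
have mU i : measurable (U i : set (borel M)) by exact: sub_sigma_algebra.
apply: (@le_trans _ _ (- C + \sum_(i < N) e * limit_mass (U i))).
  rewrite lerD2l; apply: ler_sum => i _; rewrite ler_pM2l//.
  exact: PO (oU i).
apply: ler_cvg_to _ phil _.
  apply: cvgD; first exact: cvg_cst.
  apply: cvg_big => [|i _]; first exact: add_continuous.
  by apply: cvgM; [exact: cvg_cst|exact: cvg_limit_mass (mU i)].
apply: nearW => mu /=.
by have [] := Rintegral_level_sum M_compact
  (mu : borel_probability R M) cphi (ltW e0) CN.
Qed.

Theorem ultra_cvg_wstar : exists mu : wstar R M, F --> mu.
Proof.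
have M_normal : normal_space M := compact_normal M_hausdorff M_compact.
have mC (K : set M) : closed K -> measurable (K : set (borel M)).
  move=> /closed_openC oK; rewrite -[K]setCK; apply: measurableC.
  exact: sub_sigma_algebra.
have mO (U : set M) : open U -> measurable (U : set (borel M)).
  by move=> oU; exact: sub_sigma_algebra.
have [nu [nuT nuO]] := @content_borel_measure R M M_normal M_compact limit_mass
  (fun A B cA cB => le_limit_mass (mC _ cA) (mC _ cB))
  (fun A B cA cB => limit_massU_le (mC _ cA) (mC _ cB))
  (fun A B cA cB => limit_massU (mC _ cA) (mC _ cB)).
rewrite limit_massT in nuT.
pose P : probability (borel M) R := unit_mass nuT.
have PO U : open U -> fine (P U) <= limit_mass U.
  move=> oU; rewrite -lee_fin fineK ?fin_num_measure//; last exact: mO.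
  rewrite [leLHS]nuO//; apply: ge_ereal_sup => _ [K [cK KU] <-].
  by rewrite lee_fin; apply: le_limit_mass => //; [exact: mC|exact: mO].
exists (to_borel_probability P); apply/cvg_wstar => phi.
have cphi : continuous phi by exact: cts_fun.
have cNphi : continuous (fun x => - phi x).
  by move=> x; apply: cvgN; exact: cphi.
have [C phiC] := continuous_compact_bound M_compact cphi.
have phiF : cvg ((fun mu : borel_probability R M => \int[mu]_x phi x) @ F).
  apply: (@ultra_cvg_bounded _ _ _ _ C) => // mu.
  rewrite (le_trans (le_normr_Rintegral _ _))//.
    exact: continuous_borel_integrable.
  rewrite (@le_trans _ _ (\int[mu]_x C))//; last first.
    by rewrite Rintegral_cst// [X in fine X]probability_setT mulr1.
  apply: le_Rintegral => //.
    apply: (@continuous_borel_integrable _ _ M_compact mu (fun x => `|phi x|)).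
    by move=> x; apply: cvg_norm; exact: cphi.
  exact: finite_measure_integrable_cst.
move: phiF => /cvg_ex[l phil].
rewrite /wstar_eval Rintegral_borel_restr.
suff -> : \int[P]_x phi x = l by [].
apply/eqP; rewrite eq_le (le_limit_Rintegral PO)//=.
rewrite -lerN2 -RintegralN_continuous// (le_limit_Rintegral PO)//.
rewrite (_ : (fun mu => _) =
  (fun mu : borel_probability R M => - \int[mu]_x phi x)); first exact: cvgN.
by apply/funext => mu; rewrite RintegralN_continuous.
Qed.

End limit_content.

Theorem wstar_compact : compact [set: wstar R M].
Proof.
rewrite compact_ultra => F FU _.
by have [mu Fmu] := ultra_cvg_wstar FU; exists mu.
Qed.

End wstar_compact.

(** * Continuity of the empirical measures *)

Section empirical_continuous.
Context (R : realType) (M : ptopologicalType) (f : M -> M).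
Hypotheses (M_compact : compact [set: M]) (f_continuous : continuous f).

Lemma ge0_Rintegral_empirical (phi : M -> R) x n : continuous phi ->
  (forall y, 0 <= phi y) ->
  \int[empirical_measure R f x n]_y phi y =
  n.+1%:R^-1 * \sum_(j < n.+1) phi (iter j f x).
Proof.
move=> cphi phi0.
have mphi : measurable_fun [set: borel M] (EFin \o phi).
  by apply/measurable_EFinP; exact: continuous_borel_measurable.
rewrite /Rintegral /empirical_measure ge0_integral_mscale//; last first.
  by move=> y _; rewrite lee_fin.
rewrite ge0_integral_measure_sum//; last by move=> y _; rewrite lee_fin.
rewrite (eq_bigr (fun j : 'I_n.+1 => (phi (iter j f x))%:E)) ?sumEFin//.
by move=> j _; rewrite integral_dirac// diracT mul1e.
Qed.

Lemma Rintegral_empirical (phi : M -> R) x n : continuous phi ->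
  \int[empirical_measure R f x n]_y phi y =
  n.+1%:R^-1 * \sum_(j < n.+1) phi (iter j f x).
Proof.
move=> cphi; have [C phiC] := continuous_compact_bound M_compact cphi.
have cpC : continuous (fun y => phi y + C).
  by move=> y; apply: cvgD; [exact: cphi|exact: cvg_cst].
have pC0 y : 0 <= phi y + C.
  by have := phiC y; rewrite ler_norml => /andP[]; lra.
have := ge0_Rintegral_empirical x n cpC pC0.
rewrite RintegralD//; last 2 first.
- exact: continuous_borel_integrable.
- exact: finite_measure_integrable_cst.
rewrite Rintegral_cst// [X in fine X]probability_setT mulr1.
rewrite big_split/= mulrDr sumr_const card_ord -[C *+ _]mulr_natl.
rewrite mulKf ?pnatr_eq0//.
exact: addIr.
Qed.

Lemma continuous_empirical n : continuous (fun x => empirical R f x n).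
Proof.
move=> x; apply/cvg_wstar => phi.
have cphi : continuous phi by exact: cts_fun.
pose u y := n.+1%:R^-1 * \sum_(j < n.+1) phi (iter j f y).
have evE y : wstar_eval (empirical R f y n) phi = u y.
  by rewrite /wstar_eval Rintegral_borel_restr Rintegral_empirical.
have citer j : continuous (iter j f).
  elim: j => [|j IH] y; first exact: cvg_id.
  by apply: continuous_comp; [exact: IH|exact: f_continuous].
suff : u y @[y --> x] --> u x.
  by rewrite -evE; under eq_fun do rewrite -evE.
apply: cvgM; first exact: cvg_cst.
apply: cvg_big => [|j _]; first exact: add_continuous.
by apply: continuous_comp; [exact: citer|exact: cphi].
Qed.

End empirical_continuous.

(** * Basins and observable measures *)

Section wstar_metric.
Context (R : realType) (M : ptopologicalType).
Variable dist : wstar R M -> wstar R M -> R.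
Hypothesis dist_wstar : metric_inducing_wstar dist.

Lemma wstar_distxx mu : dist mu mu = 0.
Proof. by case: dist_wstar => d0 _ _ _; exact/d0. Qed.

Lemma wstar_distC mu nu : dist mu nu = dist nu mu.
Proof. by case: dist_wstar. Qed.

Lemma wstar_dist_triangle nu mu rho : dist mu rho <= dist mu nu + dist nu rho.
Proof. by case: dist_wstar. Qed.

Lemma nbhs_wstarP mu (A : set (wstar R M)) :
  nbhs mu A <-> exists2 e, 0 < e & [set nu | dist mu nu < e] `<=` A.
Proof. by case: dist_wstar. Qed.

Lemma nbhs_wstar_ball mu e : 0 < e -> nbhs mu [set nu | dist mu nu < e].
Proof. by move=> e0; apply/nbhs_wstarP; exists e. Qed.

Lemma open_wstar_ball mu e : open [set nu | dist mu nu < e].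
Proof.
rewrite openE => nu /= nue; apply/nbhs_wstarP; exists (e - dist mu nu).
  by rewrite subr_gt0.
move=> rho /= lt_rho.
by have := wstar_dist_triangle nu mu rho; lra.
Qed.

End wstar_metric.

Section observable_measures.
Context (R : realType) (M : ptopologicalType).
Hypotheses (M_hausdorff : hausdorff_space M) (M_compact : compact [set: M]).
Variable dist : wstar R M -> wstar R M -> R.
Hypothesis dist_wstar : metric_inducing_wstar dist.
Variable f : M -> M.

(** Compactness gives a cluster point of the empirical measures along the times
    in [P]; the metric makes it the limit of a subsequence. *)
Lemma pomega_frequently x (P : set nat) :
  (forall N, exists2 n, (N <= n)%N & P n) ->
  exists (nu : wstar R M) (s : nat -> nat), [/\ {homo s : i j / (i < j)%N},
    (fun k => empirical R f x (s k)) @ \oo --> nu & forall k, P (s k)].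
Proof.
move=> PN.
have FP : ProperFilter (within P \oo).
  apply: Build_ProperFilter_ex => A [N _ NA].
  by have [n Nn Pn] := PN N; exists n; exact: NA.
have [nu [_ nuP]] := @wstar_compact R M M_hausdorff M_compact
  (empirical R f x n @[n --> within P \oo]) _ filterT.
have /choice[h hP] (kN : nat * nat) : exists n, [/\ (kN.2 <= n)%N, P n &
    dist nu (empirical R f x n) < kN.1.+1%:R^-1].
  have k0 : 0 < kN.1.+1%:R^-1 :> R by rewrite invr_gt0 ltr0n.
  have AN : (empirical R f x n @[n --> within P \oo])
      [set empirical R f x n | n in [set n | (kN.2 <= n)%N /\ P n]].
    by exists kN.2 => // n /= Nn Pn; exists n.
  have [_ [[n [Nn Pn] <-] ?]] := nuP _ _ AN (nbhs_wstar_ball dist_wstar nu k0).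
  by exists n.
(* s k is a time in P, later than s (k - 1), at which the empirical measure is
   1 / (k + 1)-close to nu *)
pose s := fix s k := if k is k'.+1 then h (k, (s k').+1) else h (0%N, 0%N).
have sP k : P (s k) /\ dist nu (empirical R f x (s k)) < k.+1%:R^-1.
  by case: k => [|k]; [have [] := hP (0%N, 0%N)|have [] := hP (k.+1, (s k).+1)].
exists nu, s; split; last by move=> k; have [] := sP k.
  apply: homo_ltn => [|k]; first exact: ltn_trans.
  by have [] := hP (k.+1, (s k).+1).
move=> A /(nbhs_wstarP dist_wstar)[e e0 eA].
have [N _ Ne] := near_infty_natSinv_lt (PosNum e0).
exists N => // k /= Nk; apply: eA => /=.
by have [_ /lt_trans] := sP k; apply; exact: Ne.
Qed.

Lemma pomega_nonempty (x : M) : @pomega R M f x !=set0.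
Proof.
have [|nu [s [hs snu _]]] := @pomega_frequently x setT.
  by move=> N; exists N.
by exists nu, s.
Qed.

Lemma basinP mu eps x :
  basin dist f mu eps x <-> exists2 nu, @pomega R M f x nu & dist mu nu < eps.
Proof.
rewrite /basin /= /dist_to_set; split.
  move=> /ereal_inf_lt[_ [nu xnu <-]]; rewrite lte_fin => ?.
  by exists nu.
move=> [nu xnu lt_eps]; apply: (@le_lt_trans _ _ (dist mu nu)%:E).
  by apply: ereal_inf_lbound; exists nu.
by rewrite lte_fin.
Qed.

(** A limit of the empirical measures at distance less than [eps] from [mu]
    leaves a margin [j.+1%:R^-1], and then infinitely many empirical measures
    stay below [eps] minus the margin. Conversely, the limit extracted from
    those is at distance at most [eps - j.+1%:R^-1]. *)
Lemma basin_limsup mu eps : basin dist f mu eps =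
  \bigcup_j \bigcap_N \bigcup_(n in [set n | (N <= n)%N])
    [set x | dist mu (empirical R f x n) < eps - j.+1%:R^-1].
Proof.
apply/seteqP; split=> x.
  move=> /basinP[nu [s hs snu] lt_eps].
  have d0 : 0 < eps - dist mu nu by rewrite subr_gt0.
  have [j _ /(_ j (leqnn j)) /= jd] := near_infty_natSinv_lt (PosNum d0).
  exists j => // N _.
  have nuj : nbhs nu [set rho | dist mu rho < eps - j.+1%:R^-1].
    apply: open_nbhs_nbhs; split; first exact: open_wstar_ball.
    by rewrite /= ltrBrDr -ltrBrDl; exact: jd.
  have [K _ sK] := snu _ nuj.
  have s_ge k : (k <= s k)%N.
    by elim: k => // k IH; rewrite (leq_ltn_trans IH)// hs.
  exists (s (maxn K N)); last by apply: sK; exact: leq_maxl.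
  exact: leq_trans (leq_maxr K N) (s_ge _).
move=> [j _ jx]; apply/basinP.
have [|nu [s [hs snu sj]]] := @pomega_frequently x
    [set n | dist mu (empirical R f x n) < eps - j.+1%:R^-1].
  by move=> N; have [n] := jx N I; exists n.
exists nu; first by exists s.
have j0 : 0 < j.+1%:R^-1 :> R by rewrite invr_gt0 ltr0n.
have [K _ /(_ K (leqnn K)) /= sK] := snu _ (nbhs_wstar_ball dist_wstar nu j0).
have := wstar_dist_triangle dist_wstar (empirical R f x (s K)) mu nu.
rewrite (wstar_distC dist_wstar (empirical R f x (s K))).
by move: (sj K) sK => /=; move: (_^-1) => c; lra.
Qed.

Hypothesis f_continuous : continuous f.

Lemma measurable_basin mu eps :
  measurable (basin dist f mu eps : set (borel M)).
Proof.
rewrite basin_limsup; apply: bigcup_measurable => j _.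
apply: bigcap_measurable => [|N _]; first by exists 0%N.
apply: bigcup_measurable => n _; apply: sub_sigma_algebra.
apply: (@open_comp _ _ (fun x => empirical R f x n)
  [set nu | dist mu nu < eps - j.+1%:R^-1]).
  by move=> x _; exact: continuous_empirical.
exact: open_wstar_ball.
Qed.

Variable m : borel_probability R M.

(** A ball meets every set of this filter when, with positive probability, some
    limit of the empirical measures falls in it: the cluster points of the
    filter are observable. *)
Let ess_pomega : set_system (wstar R M) :=
  [set S | m.-negligible [set x : borel M | ~ @pomega R M f x `<=` S]].

Let ess_pomega_proper : ProperFilter ess_pomega.
Proof.
split=> [neg0|].
  have : m setT = 0%E.
    apply/negligibleP => //; apply: negligibleS neg0 => x _ sub0.
    by have [nu /sub0] := pomega_nonempty x.
  by rewrite probability_setT => /eqP; rewrite onee_eq0.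
split=> [|S S' nS nS'|S S' SS' nS].
- by apply: negligibleS (negligible_set0 m) => x; apply.
- apply: negligibleS (negligibleU nS nS') => x /= nSS'.
  apply: contrapT => /not_orP[/contrapT xS /contrapT xS'].
  apply: nSS' => nu xnu.
  by split; [exact: xS|exact: xS'].
- apply: negligibleS nS => x /= nS'.
  by apply: contra_not nS' => /subset_trans; exact.
Qed.

Local Existing Instance ess_pomega_proper.

Lemma observable_nonempty : observable dist m f !=set0.
Proof.
have [mu [_ mu_cluster]] :=
  @wstar_compact R M M_hausdorff M_compact ess_pomega _ filterT.
exists mu => e e0; rewrite lt0e measure_ge0 andbT; apply/negP => /eqP m0.
have far : ess_pomega (~` [set nu | dist mu nu < e]).
  exists (basin dist f mu e); split=> //; first exact: measurable_basin.
  move=> x /existsNP[nu /not_implyP[xnu /contrapT ?]].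
  by apply/basinP; exists nu.
by have [nu []] := mu_cluster _ _ far (nbhs_wstar_ball dist_wstar mu e0).
Qed.

Lemma closed_observable : closed (observable dist m f).
Proof.
move=> mu clmu eps eps0.
have e20 : 0 < eps / 2 by rewrite divr_gt0.
have [nu [nuO numu]] := clmu _ (nbhs_wstar_ball dist_wstar mu e20).
apply: (lt_le_trans (nuO _ e20)); apply: le_measure; rewrite ?inE.
- exact: measurable_basin.
- exact: measurable_basin.
move=> x /basinP[rho xrho nurho]; apply/basinP; exists rho => //.
by have := wstar_dist_triangle dist_wstar nu mu rho; move: numu => /=; lra.
Qed.

End observable_measures.

Theorem theorem1p3 (R : realType) (n : nat) (M : ptopologicalType)
    (M_hausdorff : hausdorff_space M) (M_countable : @second_countable M)
    (M_compact : compact [set: M]) (A : C1_atlas R n M)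
    (m : borel_probability R M) (m_lebesgue : lebesgue_on A m)
    (dist : wstar R M -> wstar R M -> R)
    (dist_wstar : metric_inducing_wstar dist)
    (f : M -> M) (f_continuous : continuous f) :
  observable dist m f !=set0 /\ compact (observable dist m f).
Proof.
split; first exact: observable_nonempty.
apply: (subclosed_compact _ (wstar_compact M_hausdorff M_compact)) => //.
exact: closed_observable.
Qed.
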